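(* The map $\rho_o:\mathcal S_o\to\mathcal S_o$ is invertible (up to null sets), and the diagram formed by $\rho_o$, $\tilde T_o$ and $J_o$ commutes, i.e. $$J_o\circ\rho_o=\tilde T_o\circ J_o \quad\text{on } \mathcal S_o ,$$ where $J_o:\mathcal S_o\to\tilde\Omega_o$ is the invertible map defined by $$J_o(x,y):=\operatorname{sign}(x)\,(1/x,-y,1)=\begin{cases}(1/x,-y,1) & \text{if } x>1,\ y\in -I_G,\\ (-1/x,y,-1) & \text{if } x<-1,\ y\in I_G.\end{cases}$$
   Context: Let $G=\tfrac12(\sqrt5+1)$, $I_G=(G-2,G)$, $-I_G=(-G,2-G)$, and $$\mathcal S_o=\big((1,\infty)\times(-I_G)\big)\cup\big((-\infty,-1)\times I_G\big),\qquad \Omega_o=(0,1)\times I_G,\qquad \tilde\Omega_o=\Omega_o\times\{-1,1\}.$$ Odd continued fraction (OCF) digits: for $x\in(0,1)$ irrational, the first digit $(a_1(x),\epsilon_1(x))$ is $(2k-1,+1)$ if $x\in(\frac1{2k},\frac1{2k-1})$, $k\ge1$, and $(2k-1,-1)$ if $x\in(\frac1{2k-1},\frac1{2k-2})$, $k\ge2$. The odd Gauss map is $T_o(x)=\epsilon_1(x)\big(\frac1x-a_1(x)\big)$. Define $$\bar T_o:\Omega_o\to\Omega_o,\quad \bar T_o(x,y)=\Big(T_o(x),\frac{\epsilon_1(x)}{a_1(x)+y}\Big),\qquad \tilde T_o:\tilde\Omega_o\to\tilde\Omega_o,\quad \tilde T_o(x,y,\epsilon)=\big(\bar T_o(x,y),-\epsilon_1(x)\epsilon\big).$$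 The map $\rho_o$ on $\mathcal S_o$: for $(x,y)\in\mathcal S_o$ put $\epsilon=\operatorname{sign}(x)$ and let $a_1=a_1(1/|x|)$, so that $a_1=2k+1$ if $|x|\in(2k,2k+1)$ with $k\ge1$, and $a_1=2k-1$ if $|x|\in(2k-1,2k)$ with $k\ge1$. Then $$\rho_o(x,y)=\Big(\frac{1}{\epsilon a_1-x},\frac1{\epsilon a_1-y}\Big).$$ The maps are considered on points with irrational coordinates, and Lebesgue-null sets are neglected. *)

(* Defs.v *)
From HB Require Import structures.
From mathcomp Require Import all_boot all_order all_algebra.
From mathcomp Require Import all_classical all_reals all_analysis.
From mathcomp Require Import lra.

Set Implicit Arguments.
Unset Strict Implicit.
Unset Printing Implicit Defensive.

Import Order.TTheory GRing.Theory Num.Theory.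
Import numFieldNormedType.Exports.

Local Open Scope classical_set_scope.
Local Open Scope ring_scope.

(* The self-map [f] of [A] is invertible up to [mu]-null sets: it restricts to a
   bijection of [A `\` N] onto itself for some null set [N].  [N] is the same on
   both sides, so that both [f] and its inverse can be iterated off [N]. *)
Definition invertible_mod_null d (T : measurableType d) (R : realType)
    (mu : set T -> \bar R) (A : set T) (f : T -> T) : Prop :=
  exists2 N : set T, mu.-negligible N & set_bij (A `\` N) (A `\` N) f.

Section OddContinuedFractions.
Context {R : realType}.

Definition G : R := 2^-1 * (Num.sqrt 5 + 1).

Definition I_G : set R := `]G - 2, G[.

Definition opp_I_G : set R := `](- G), (2 - G)[.

Definition S_o : set (R * R) :=
  (`]1, +oo[ `*` opp_I_G) `|` (`]-oo, (-1)[ `*` I_G).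

Definition Omega_o : set (R * R) := `]0, 1[ `*` I_G.

Definition tOmega_o : set (R * R * R) := Omega_o `*` [set -1; 1].

(* The points of [S_o] and of [tOmega_o] with irrational coordinates. *)
Definition S_o_irr : set (R * R) := S_o `&` (irrational `*` irrational).

Definition tOmega_o_irr : set (R * R * R) :=
  tOmega_o `&` ((irrational `*` irrational) `*` setT).

(* [d = (a_1, eps_1)] is the first digit of [x]; both entries are integers,
   embedded in [R]. *)
Definition is_ocf_digit (x : R) (d : R * R) : Prop :=
  (exists k : nat, [/\ (1 <= k)%N, d = (2 * k%:R - 1, 1)
     & x \in `](1 / (2 * k%:R)), (1 / (2 * k%:R - 1))[ ]) \/
  (exists k : nat, [/\ (2 <= k)%N, d = (2 * k%:R - 1, -1)
     & x \in `](1 / (2 * k%:R - 1)), (1 / (2 * k%:R - 2))[ ]).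

(* The default value is only reached when [x] is not in [`]0, 1[] or is the
   inverse of an integer, in particular never at an irrational of [`]0, 1[]. *)
Definition ocf_digit (x : R) : R * R := xget (0, 0) [set d | is_ocf_digit x d].

Definition a_1 (x : R) : R := (ocf_digit x).1.

Definition eps_1 (x : R) : R := (ocf_digit x).2.

Definition T_o (x : R) : R := eps_1 x * (1 / x - a_1 x).

Definition barT_o (p : R * R) : R * R :=
  (T_o p.1, eps_1 p.1 / (a_1 p.1 + p.2)).

Definition tT_o (q : R * R * R) : R * R * R :=
  (barT_o q.1, - eps_1 q.1.1 * q.2).

Definition rho_o (p : R * R) : R * R :=
  let eps := Num.sg p.1 in
  let a := a_1 (1 / `|p.1|) in
  (1 / (eps * a - p.1), 1 / (eps * a - p.2)).

Definition J_o (p : R * R) : R * R * R :=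
  let s := Num.sg p.1 in (s * (1 / p.1), s * - p.2, s * 1).

Lemma is_ocf_digit_ceil (x : R) d : is_ocf_digit x d ->
  exists2 n : nat, n%:R < 1 / x < n.+1%:R &
    d = if odd n then (n%:R, 1) else (n.+1%:R, -1).
Proof.
move=> [|] [k [k1 -> ]]; rewrite in_itv/= => /andP[h1 h2].
- case: k k1 h1 h2 => [//|k] _ h1 h2.
  have k0 : (0 : R) <= k%:R by [].
  have x0 : 0 < x by apply: lt_trans h1; rewrite divr_gt0// mulr_gt0.
  have E : (2 * k.+1%:R - 1 : R) = (k.*2.+1)%:R.
    by rewrite -muln2 -!natr1 natrM; lra.
  have E' : (2 * k.+1%:R : R) = (k.*2.+2)%:R.
    by rewrite -muln2 -!natr1 natrM; lra.
  exists k.*2.+1; last by rewrite /= odd_double E.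
  move: h1 h2; rewrite E E' !div1r => h1 h2.
  by rewrite -[_.+1%:R]invrK ltf_pV2 ?posrE ?invr_gt0// h2/=
    -[ltRHS]invrK ltf_pV2 ?posrE ?invr_gt0.
- case: k k1 h1 h2 => [//|[//|k]] _ h1 h2.
  have E : (2 * k.+2%:R - 1 : R) = (k.+1.*2.+1)%:R.
    by rewrite -muln2 -!natr1 natrM -!natr1; lra.
  have E' : (2 * k.+2%:R - 2 : R) = (k.+1.*2)%:R.
    by rewrite -muln2 natrM -!natr1; lra.
  have x0 : 0 < x by apply: lt_trans h1; rewrite E divr_gt0.
  exists k.+1.*2; last by rewrite odd_double E.
  move: h1 h2; rewrite E E' !div1r => h1 h2.
  by rewrite -[(_.*2)%:R]invrK ltf_pV2 ?posrE ?invr_gt0// h2/=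
    -[ltRHS]invrK ltf_pV2 ?posrE ?invr_gt0.
Qed.

Lemma ocf_digitP (x : R) d : is_ocf_digit x d -> ocf_digit x = d.
Proof.
move=> xd; apply: xget_unique => //= d'.
have [n /andP[n1 n2] ->] := is_ocf_digit_ceil xd.
move=> /is_ocf_digit_ceil[m /andP[m1 m2] ->].
suff -> : m = n by [].
have := lt_trans n1 m2; have := lt_trans m1 n2.
by rewrite !ltr_nat !ltnS => mn nm; apply/eqP; rewrite eqn_leq mn.
Qed.

Lemma J_o_pos (x y : R) : 1 < x -> J_o (x, y) = (1 / x, - y, 1).
Proof.
by move=> x1; rewrite /J_o/= gtr0_sg ?mul1r//; apply: lt_trans x1.
Qed.

Lemma J_o_neg (x y : R) : x < -1 -> J_o (x, y) = (- 1 / x, y, -1).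
Proof.
move=> x1; rewrite /J_o/= ltr0_sg; last by lra.
by rewrite !mulN1r opprK mul1r.
Qed.

End OddContinuedFractions.

(* Main.v *)
Require Import Defs.
From mathcomp Require Import all_boot all_order all_algebra.
From mathcomp Require Import all_classical all_reals all_analysis.
From mathcomp Require Import ring lra.
Import Order.TTheory GRing.Theory Num.Theory.
Import numFieldNormedType.Exports.
Local Open Scope classical_set_scope.
Local Open Scope ring_scope.

Set Implicit Arguments.
Unset Strict Implicit.
Unset Printing Implicit Defensive.

(** In suitable coordinates both maps are the natural extension of the odd
    Gauss map.  Every irrational [x] of [`]0, 1[] is uniquely
    [1 / (2 m + 1 + e u)] with [0 < u < 1], [e] a sign and [(m, e)] distinct
    from [(0, -1)]; then [(2 m + 1, e)] is the first digit of [x], and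

      [tT_o (1 / (2 m + 1 + e u), y, s) = (u, e / (2 m + 1 + y), - e s)]

    (lemmas [branch_cover] and [tT_oE]).  Applying to such a point the inverse
    [(x, y, s) |-> (s / x, - s y)] of [J_o] before [rho_o], or after [tT_o],
    gives in both cases [(- e s / u, s / (2 m + 1 + y))]; this is the
    commutation of the diagram ([rho_o_J_inv]).  Since [J_o] is a bijection,
    every property of [rho_o] follows from the same property of [tT_o].

    It remains to see that [tT_o] is bijective.  The base point [u] and the
    sign [- e s] carry no information on the branch [(m, e)], so everything is
    in the fibres: as [(m, e)] varies, the maps [y |-> e / (2 m + 1 + y)] have
    to tile [I_G].  Because [I_G] has length 2 and the odd numbers have
    spacing 2, the translates [2 m + 1 + I_G] tile the half-line
    [`]G - 1, +oo[] up to their endpoints, and those with [m > 0] tile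
    [`]G + 1, +oo[].  Inversion sends these half-lines to [`]0, G[] and
    [`]0, 2 - G[], by the identities [1 / (G - 1) = G] and
    [1 / (G + 1) = 2 - G].  So the branches with [e = 1] tile [`]0, G[] and
    those with [e = -1] tile [`]G - 2, 0[]
    ([branch_fibre], [branch_fibre_inj], [branch_fibre_cover]).

    What the tiling misses is [0] and numbers of the field generated by [G],
    and this field contains irrational numbers.  Irrationality of the
    coordinates therefore makes [rho_o] well defined but not surjective.  The
    dynamics preserves the complement of any subfield, in each coordinate
    separately; off a subfield that contains [G] nothing is missed.  The null
    set removed here consists of the points with an algebraic coordinate: it
    is null because there are countably many algebraic numbers. *)

(** * The golden ratio *)

Section GoldenRatio.
Context {R : realType}.

Lemma G_sqr : (G : R) ^+ 2 = G + 1.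
Proof.
have s5 : Num.sqrt (5 : R) ^+ 2 = 5 by rewrite sqr_sqrtr.
rewrite /G; set s := Num.sqrt 5 in s5 *.
have -> : (2^-1 * (s + 1)) ^+ 2 = 4^-1 * (s ^+ 2 + 2 * s + 1) by field.
by rewrite s5; field.
Qed.

Lemma G_itv : 1 < (G : R) < 2.
Proof.
have G0 : 0 < (G : R) by rewrite /G mulr_gt0// ltr_wpDl.
have := G_sqr; rewrite expr2 => GG.
by apply/andP; split; rewrite ltNge; apply/negP => h; nra.
Qed.

Lemma invG : (G : R)^-1 = G - 1.
Proof.
have /andP[G1 _] := G_itv; have := G_sqr; rewrite expr2 => GG.
have G0 : (G : R) != 0 by rewrite gt_eqF//; lra.
by apply: (mulIf G0); rewrite mulVf// mulrBl; lra.
Qed.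

Lemma invG1 : ((G : R) + 1)^-1 = 2 - G.
Proof.
have /andP[G1 _] := G_itv; have := G_sqr; rewrite expr2 => GG.
have G0 : (G : R) + 1 != 0 by rewrite gt_eqF//; lra.
by apply: (mulIf G0); rewrite mulVf// mulrBl mulrDr; lra.
Qed.

End GoldenRatio.

(** * Inverse branches of the odd Gauss map *)

Section Branches.
Context {R : realType}.
Implicit Types (m : nat) (e u x y z : R).

(** Index of the inverse branch [u |-> 1 / (2 m + 1 + e u)], that is, of the
    digit [(2 m + 1, e)].  The pair [(0, -1)] would send [`]0, 1[] outside
    itself. *)
Definition branch m e : Prop := e = 1 \/ e = -1 /\ (0 < m)%N.

Lemma branch_sqr m e : branch m e -> e * e = 1.
Proof. by move=> [->|[-> _]]; rewrite ?mulr1 ?mulrNN ?mulr1. Qed.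

Lemma branch_gt1 m e u : branch m e -> 0 < u < 1 -> 1 < 2 * m%:R + 1 + e * u.
Proof.
have m0 : 0 <= m%:R :> R by [].
move=> [->|[-> m1]] /andP[u0 u1]; first by lra.
have {}m1 : 1 <= m%:R :> R by rewrite ler1n.
by lra.
Qed.

Lemma ocf_digit_branch m e u : branch m e -> 0 < u < 1 ->
  ocf_digit (1 / (2 * m%:R + 1 + e * u)) = (2 * m%:R + 1, e).
Proof.
move=> me u01; have t1 := branch_gt1 me u01; case/andP: u01 => u0 u1.
have m0 : 0 <= m%:R :> R by [].
have a_eq : 2 * m%:R + 1 = 2 * m.+1%:R - 1 :> R by rewrite -natr1; lra.
apply: ocf_digitP; case: me t1 => [->|[-> m1]] t1; [left|right];
  exists m.+1; split=> //; rewrite ?a_eq// in_itv/= !div1r.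
  by rewrite !ltf_pV2 ?posrE -natr1; (try lra); apply/andP; split; lra.
have {}m1 : 1 <= m%:R :> R by rewrite ler1n.
by rewrite !ltf_pV2 ?posrE -natr1; (try lra); apply/andP; split; lra.
Qed.

(** The odd number [2 m + 1] nearest to [x^-1] is at distance less than 1
    unless [x^-1] is an even integer, and [e] is the side on which [x^-1]
    lies. *)
Lemma branch_cover x : 0 < x < 1 -> (forall n, x^-1 != n%:R) ->
  exists m e u, [/\ branch m e, 0 < u < 1 & x = 1 / (2 * m%:R + 1 + e * u)].
Proof.
move=> /andP[x0 x1] xN.
rewrite -[x]invrK; set t := x^-1 in xN *.
have t1 : 1 < t by rewrite invf_gt1.
have [m /andP[]] : exists m : nat, m%:R <= t / 2 < m.+1%:R.
  by exists (Num.truncn (t / 2)); apply: truncn_itv; lra.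
rewrite -[m.+1%:R]natr1 => ml mu.
have m2 : 2 * m%:R != t by rewrite eq_sym -natrM.
have m21 : 2 * m%:R + 1 != t by rewrite eq_sym -natrM natr1.
have {}ml : 2 * m%:R < t by rewrite lt_neqAle m2/=; lra.
have [lt|gt|eq] := ltgtP (2 * m%:R + 1) t; last by rewrite eq eqxx in m21.
- exists m, 1, (t - (2 * m%:R + 1)); split; first by left.
    by apply/andP; split; lra.
  by rewrite div1r; congr (_^-1); ring.
- exists m, (-1), (2 * m%:R + 1 - t); split.
  + (* if [m = 0], then [x^-1 < 1] *)
    right; split=> //; rewrite lt0n; apply/eqP => m0.
    by move: gt; rewrite m0 mulr0n; lra.
  + by apply/andP; split; lra.
  + by rewrite div1r; congr (_^-1); ring.
Qed.

Lemma branch_fibre_gt m y : I_G y -> G - 1 < 2 * m%:R + 1 + y.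
Proof.
by rewrite /I_G /= in_itv/= => /andP[y0 _]; have : 0 <= m%:R :> R by []; lra.
Qed.

(** This is where the value of [G] matters: the extreme cases [m = 0], [e = 1]
    and [m = 1], [e = -1] give exactly the two endpoints of [I_G]. *)
Lemma branch_fibre m e y : branch m e -> I_G y ->
  I_G (e / (2 * m%:R + 1 + y)).
Proof.
have /andP[G1 G2] := @G_itv R.
move=> me Iy; have yG := branch_fibre_gt m Iy.
rewrite /I_G /= in_itv/=; case: me => [->|[-> m1]].
  rewrite div1r; apply/andP; split.
    by apply: (@lt_trans _ _ 0); rewrite ?invr_gt0; lra.
  by rewrite -[ltRHS]invrK invG ltf_pV2 ?posrE//; lra.
have {}m1 : 1 <= m%:R :> R by rewrite ler1n.
move: Iy; rewrite /I_G/= in_itv/= => /andP[y0 y1].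
rewrite mulN1r; apply/andP; split.
  by rewrite ltrNr opprB -invG1 ltf_pV2 ?posrE//; lra.
by apply: (@lt_trans _ _ 0); rewrite ?oppr_lt0 ?invr_gt0; lra.
Qed.

(** The sign of the value determines [e], because the denominators are
    positive; then [m] is determined because the translates of [I_G] by
    distinct odd numbers are disjoint. *)
Lemma branch_fibre_inj m m' e e' y y' :
  branch m e -> branch m' e' -> I_G y -> I_G y' ->
  e / (2 * m%:R + 1 + y) = e' / (2 * m'%:R + 1 + y') ->
  [/\ m = m', e = e' & y = y'].
Proof.
have /andP[G1 G2] := @G_itv R.
move=> me me' Iy Iy' E.
have w0 := branch_fibre_gt m Iy; have w0' := branch_fibre_gt m' Iy'.
have ee : e = e'.
  have : 0 < (2 * m%:R + 1 + y)^-1 by rewrite invr_gt0; lra.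
  have : 0 < (2 * m'%:R + 1 + y')^-1 by rewrite invr_gt0; lra.
  by move: E; case: me => [->|[-> _]]; case: me' => [->|[-> _]] //; lra.
move: E; rewrite -ee => /(congr1 (fun t => e * t)).
rewrite !mulrA (branch_sqr me) !mul1r => /invr_inj E.
move: Iy Iy'; rewrite /I_G/= !in_itv/= => /andP[? ?] /andP[? ?].
have mm : m = m'.
  apply/eqP; rewrite eqn_leq -[(m <= m')%N]ltnS -[(m' <= m)%N]ltnS.
  rewrite -!(ltr_nat R) -[m.+1%:R]natr1 -[m'.+1%:R]natr1.
  by apply/andP; split; lra.
by split=> //; move: E; rewrite mm => /addrI.
Qed.

(** The excluded values of [`|z|^-1] are the left endpoints [2 n - 1 + G] of
    the translates of [I_G] by odd numbers. *)
Lemma branch_fibre_cover z : I_G z -> z != 0 ->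
  (forall n, `|z|^-1 + 1 != 2 * n%:R + G) ->
  exists m e y, [/\ branch m e, I_G y & z = e / (2 * m%:R + 1 + y)].
Proof.
have /andP[G1 G2] := @G_itv R.
rewrite /I_G/= in_itv/= => /andP[z0 z1] zN0 zN.
have nz0 : 0 < `|z| by rewrite normr_gt0.
set w := `|z|^-1 in zN *.
have zw : z = Num.sg z / w by rewrite /w invrK -numEsg.
have wG : G - 1 < w.
  rewrite /w -[ltLHS]invrK ltf_pV2 ?posrE//; last by rewrite invr_gt0; lra.
  by rewrite -invG invrK ltr_norml; apply/andP; split; lra.
(* [m] is the index of the translate [2 m + 1 + I_G] that contains [w] *)
have [m /andP[]] : exists m : nat, m%:R <= (w - (G - 1)) / 2 < m.+1%:R.
  by exists (Num.truncn ((w - (G - 1)) / 2)); apply: truncn_itv; lra.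
rewrite -[m.+1%:R]natr1 => ml mu.
have ml' : 2 * m%:R + G < w + 1.
  by rewrite lt_neqAle eq_sym zN/=; lra.
exists m, (Num.sg z), (w - (2 * m%:R + 1)); split.
- case: (ltgtP z 0) zN0 => // zs _; [right|left]; last by rewrite gtr0_sg.
  rewrite ltr0_sg//; split=> //.
  rewrite lt0n; apply/eqP => m0; move: mu; rewrite m0 mulr0n.
  (* a negative [z] of [I_G] has [`|z| < 2 - G], hence [m > 0] *)
  have : G + 1 < w; last by lra.
  rewrite /w -[ltLHS]invrK ltf_pV2 ?posrE//; last by rewrite invr_gt0; lra.
  by rewrite invG1 ltr0_norm//; lra.
- by rewrite /= in_itv/=; apply/andP; split; lra.
- by rewrite [X in _ / X]addrC subrK.
Qed.

End Branches.

(** * Subfields and the branches *)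

Section Subfields.
Context {R : realType}.

Definition is_subfield (K : set R) : Prop :=
  [/\ K 1, forall x y, K x -> K y -> K (x - y) &
     forall x y, K x -> K y -> K (x / y)].

Context (K : set R) (sK : is_subfield K).

Lemma subfield0 : K 0.
Proof. by have [K1 KB _] := sK; rewrite -(subrr 1); exact: KB. Qed.

Lemma subfieldN x : K x -> K (- x).
Proof.
by have [_ KB _] := sK => Kx; rewrite -sub0r; apply: KB => //; exact: subfield0.
Qed.

Lemma subfieldD x y : K x -> K y -> K (x + y).
Proof.
have [_ KB _] := sK => Kx Ky; rewrite -[y]opprK.
by apply: KB => //; exact: subfieldN.
Qed.

Lemma subfieldV x : K x -> K x^-1.
Proof. by have [K1 _ Kd] := sK => Kx; rewrite -div1r; exact: Kd. Qed.

Lemma subfield_nat n : K n%:R.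
Proof.
have [K1 _ _] := sK; elim: n => [|n IHn]; first exact: subfield0.
by rewrite -natr1; exact: subfieldD.
Qed.

Lemma subfieldM x y : K x -> K y -> K (x * y).
Proof.
have [_ _ Kd] := sK => Kx Ky; rewrite -[y]invrK.
by apply: Kd => //; exact: subfieldV.
Qed.

Lemma subfield_odd m : K (2 * m%:R + 1).
Proof. by rewrite -natrM natr1; exact: subfield_nat. Qed.

Lemma subfield_sign m e : branch m e -> K e.
Proof. by have [K1 _ _] := sK; case=> [->|[-> _]] //; exact: subfieldN. Qed.

(** A branch acts on each coordinate by a homography with coefficients in the
    prime field, so both coordinates enter or leave [K] only together with
    their images. *)
Lemma subfield_base m e u : branch m e ->
  K (1 / (2 * m%:R + 1 + e * u)) <-> K u.
Proof.
move=> me; have Ke := subfield_sign me; have Ka := subfield_odd m.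
have [_ KB _] := sK; rewrite div1r; split => [/subfieldV|Ku].
  rewrite invrK => /(KB _ _)/(_ Ka); rewrite addrC addKr => /(subfieldM Ke).
  by rewrite mulrA (branch_sqr me) mul1r.
by apply/subfieldV/subfieldD => //; exact: subfieldM.
Qed.

Lemma subfield_fibre m e y : branch m e ->
  K (e / (2 * m%:R + 1 + y)) <-> K y.
Proof.
move=> me; have Ke := subfield_sign me; have Ka := subfield_odd m.
have [_ KB _] := sK; split => [/(subfieldM Ke)/subfieldV|Ky].
  rewrite mulrA (branch_sqr me) mul1r invrK => /(KB _ _)/(_ Ka).
  by rewrite addrC addKr.
by apply/subfieldM/subfieldV/subfieldD.
Qed.

End Subfields.

(** * Points with an algebraic coordinate *)

Section NullSet.
Context {R : realType}.

Definition algebraic : set R := [set x | algebraicOver (ratr : rat -> R) x].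

Lemma finite_roots (p : {poly R}) : p != 0 -> finite_set [set x | root p x].
Proof.
move=> p0; apply: contrapT => /infinite_set_fset -/(_ (size p))[B Bp].
rewrite leqNgt => /negP; apply.
apply: max_poly_roots => //; last exact: finmap.fset_uniq.
by apply/allP => x /Bp.
Qed.

Lemma countable_algebraic : countable algebraic.
Proof.
have -> : algebraic = \bigcup_(p in [set p : {poly rat} | p != 0])
    [set x | root (map_poly (ratr : rat -> R) p) x].
  by apply/seteqP; split => x [p]; exists p.
apply: bigcup_countable => [|p /= p0]; first exact: countableP.
apply: finite_set_countable.
by apply: finite_roots; rewrite map_poly_eq0.
Qed.

Lemma algebraic_G : algebraic G.
Proof.
exists ('X ^+ 2 - 'X - 1).
  (* the value at 0 is [-1] *)
  apply/eqP => /(congr1 (fun p => p.[0])).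
  by rewrite !hornerE.
rewrite /root !rmorphB/= rmorphXn/= map_polyX rmorph1 !hornerE.
by rewrite G_sqr; apply/eqP; ring.
Qed.

Lemma is_subfield_rational : is_subfield (@rational R).
Proof.
split; first by exists 1 => //; rewrite rmorph1.
  by move=> _ _ [p _ <-] [q _ <-]; exists (p - q) => //; rewrite rmorphB.
by move=> _ _ [p _ <-] [q _ <-]; exists (p / q) => //; rewrite fmorph_div.
Qed.

Lemma is_subfield_algebraic : is_subfield algebraic.
Proof.
split; [exact: algebraic1|exact: algebraic_sub|exact: algebraic_div].
Qed.

Lemma negligible_cross (K : set R) : countable K ->
  ((@lebesgue_measure R) \x (@lebesgue_measure R))%E.-negligible
    ((K `*` setT) `|` (setT `*` K)).
Proof.
move=> cK; have K0 := countable_lebesgue_measure0 cK.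
have mK : measurable K by exact: countable_measurable.
by apply: negligibleU; apply/negligibleP; (try exact: measurableX);
  rewrite [LHS]product_measure1E//= K0 ?mul0e ?mule0.
Qed.

End NullSet.

(** * The conjugacy *)

Section Domains.
Context {R : realType}.
Implicit Types (K : set R) (m : nat) (e u x y z s : R).

(** With [K] the rationals, the algebraic numbers and the empty set, these
    domains are respectively that of the diagram, one on which the dynamics is
    invertible, and the whole of [tOmega_o] and [S_o]. *)
Definition tOmega_off K : set (R * R * R) :=
  tOmega_o `&` ((~` K `*` ~` K) `*` setT).

Definition S_off K : set (R * R) := S_o `&` (~` K `*` ~` K).

Section Conjugacy.
Context (K : set R).
Context (KN : forall x, K x -> K (- x)) (KV : forall x, K x -> K x^-1).

Let offN x : ~ K x -> ~ K (- x).
Proof. by move=> h /KN; rewrite opprK. Qed.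

Let offV x : ~ K x -> ~ K x^-1.
Proof. by move=> h /KV; rewrite invrK. Qed.

Definition J_inv (q : R * R * R) : R * R := (q.2 / q.1.1, - (q.2 * q.1.2)).

Lemma J_oK p : S_o p -> J_inv (J_o p) = p.
Proof.
case: p => x y [[/= + _]|[/= + _]]; rewrite in_itv/= ?andbT => hx.
  by rewrite J_o_pos// /J_inv/= !mul1r invrK opprK.
by rewrite J_o_neg// /J_inv/= !mulN1r invrN invrK !opprK.
Qed.

Lemma J_invK q : tOmega_o q -> J_o (J_inv q) = q.
Proof.
case: q => [[x y] s] [[/= + _] + ]; rewrite in_itv/= => /andP[x0 x1].
have vx : 1 < x^-1 by rewrite invf_gt1.
move=> [->|->]; rewrite /J_inv/= ?mulN1r ?mul1r.
  by rewrite J_o_neg ?ltrN2// mulN1r invrN !opprK invrK.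
by rewrite J_o_pos// opprK div1r invrK.
Qed.

Lemma J_o_set_fun : set_fun (S_off K) (tOmega_off K) J_o.
Proof.
case=> x y [+ [/= Kx Ky]].
case=> -[/=]; rewrite /opp_I_G /I_G /= !in_itv/= ?andbT => hx /andP[y0 y1].
  rewrite J_o_pos//; split; last by do !split=> //=; rewrite ?div1r; auto.
  have x0 : 0 < x by lra.
  split; last by right.
  split; rewrite /I_G/= in_itv/=; last by apply/andP; split; lra.
  by rewrite div1r invr_gt0 x0/= invf_lt1.
rewrite J_o_neg//; split.
  split; last by left.
  split; rewrite /I_G/= in_itv/=; last by apply/andP; split; lra.
  rewrite mulN1r -invrN; have x0 : 1 < - x by lra.
  by rewrite invr_gt0 invf_lt1; lra.
by do !split=> //=; rewrite mulN1r; auto.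
Qed.

Lemma J_inv_set_fun : set_fun (tOmega_off K) (S_off K) J_inv.
Proof.
case=> [[x y] s] [[[/=]]]; rewrite /I_G/= !in_itv/= => /andP[x0 x1] /andP[y0 y1].
have vx : 1 < x^-1 by rewrite invf_gt1.
move=> hs [[/= Kx Ky] _]; rewrite /J_inv/=.
case: hs => ->; rewrite ?mulN1r ?mul1r; split.
- by right; split; rewrite /I_G/= in_itv/=; [lra|apply/andP; split; lra].
- by split=> /=; auto.
- by left; split; rewrite /opp_I_G/= in_itv/= ?andbT//; apply/andP; split; lra.
- by split=> /=; auto.
Qed.

Lemma J_o_bij : set_bij (S_off K) (tOmega_off K) J_o.
Proof.
split; first exact: J_o_set_fun.
  move=> p q /set_mem[Sp _] /set_mem[Sq _] E.
  by rewrite -(J_oK Sp) E J_oK.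
move=> q hq; exists (J_inv q); first exact: J_inv_set_fun.
by apply: J_invK; case: hq.
Qed.

Lemma J_inv_bij : set_bij (tOmega_off K) (S_off K) J_inv.
Proof.
split; first exact: J_inv_set_fun.
  move=> p q /set_mem[Op _] /set_mem[Oq _] E.
  by rewrite -(J_invK Op) E J_invK.
move=> p hp; exists (J_o p); first exact: J_o_set_fun.
by apply: J_oK; case: hp.
Qed.

End Conjugacy.

(** * The natural extension *)

Section NaturalExtension.
Context (K : set R) (sK : is_subfield K).

Lemma tOmega_offP q : tOmega_off K q -> exists m e u y s,
  [/\ branch m e, 0 < u < 1, ~ K u, I_G y /\ ~ K y &
    (s = -1 \/ s = 1) /\ q = (1 / (2 * m%:R + 1 + e * u), y, s)].
Proof.
case: q => [[x y] s] [[[/= + Iy] hs] [[/= Kx Ky] _]]; rewrite in_itv/= => x01.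
have xN n : x^-1 != n%:R.
  apply/eqP => xn; apply: Kx; rewrite -[x]invrK xn.
  by apply: (subfieldV sK); exact: subfield_nat.
have [m [e [u [me u01 xE]]]] := branch_cover x01 xN.
exists m, e, u, y, s; split=> //; last by rewrite xE.
by move=> Ku; apply: Kx; rewrite xE; exact/(subfield_base sK _ me).
Qed.

(** On a branch, [T_o] returns [e ^ 2 u = u]. *)
Lemma tT_oE m e u y s : branch m e -> 0 < u < 1 ->
  tT_o (1 / (2 * m%:R + 1 + e * u), y, s)
  = (u, e / (2 * m%:R + 1 + y), - (e * s)).
Proof.
move=> me u01; rewrite /tT_o /barT_o /T_o /eps_1 /a_1/= ocf_digit_branch//=.
by rewrite !div1r invrK [_ + e * u]addrC addrK mulrA (branch_sqr me) mul1r mulNr.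
Qed.

Lemma tT_o_set_fun : set_fun (tOmega_off K) (tOmega_off K) tT_o.
Proof.
move=> q /tOmega_offP[m [e [u [y [s [me u01 Ku [Iy Ky] [hs ->]]]]]]].
rewrite tT_oE//; split.
  split=> /=; last first.
    by case: me => [->|[-> _]]; case: hs => ->; rewrite ?mul1r ?mulN1r ?opprK;
      [right|left|left|right].
  by split; rewrite /= ?in_itv//; exact: branch_fibre.
by do 2!split=> //=; move/(subfield_fibre sK _ me).
Qed.

(** With [t = 2 m + 1 + e u], the point [J_inv q] is [(s t, - s y)], so that
    [rho_o] subtracts its coordinates from [s (2 m + 1)]; since [s] and [e] are
    their own inverses, both sides are [(- e s / u, s / (2 m + 1 + y))]. *)
Lemma rho_o_J_inv q : tOmega_off K q -> rho_o (J_inv q) = J_inv (tT_o q).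
Proof.
move=> /tOmega_offP[m [e [u [y [s [me u01 Ku [Iy Ky] [hs ->]]]]]]].
rewrite tT_oE// /rho_o /J_inv/=.
have t1 := branch_gt1 me u01; set t := 2 * m%:R + 1 + e * u in t1 *.
have -> : s / (1 / t) = s * t by rewrite div1r invrK.
have -> : Num.sg (s * t) = s.
  rewrite sgrM (@gtr0_sg _ t) ?mulr1; last by lra.
  by case: hs => ->; rewrite ?sgrN1 ?sgr1.
have -> : `|s * t| = t.
  rewrite normrM (@gtr0_norm _ t); last by lra.
  by case: hs => ->; rewrite ?normrN1 ?normr1 mul1r.
have w0 := branch_fibre_gt m Iy; have /andP[G1 G2] := @G_itv R.
have /andP[u0 u1] := u01.
rewrite /a_1 ocf_digit_branch//=.
have w1 : 2 * m%:R + 1 + y != 0 by rewrite gt_eqF; lra.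
have u2 : u != 0 by rewrite gt_eqF.
have -> : s * (2 * m%:R + 1) - s * t = - (s * e * u) by rewrite /t; ring.
have -> : s * (2 * m%:R + 1) - - (s * y) = s * (2 * m%:R + 1 + y) by ring.
by case: me => [->|[-> _]]; case: hs => ->; congr pair; field.
Qed.

Lemma rho_o_factor p : S_off K p -> rho_o p = J_inv (tT_o (J_o p)).
Proof.
move=> Sp; rewrite -{1}(J_oK Sp.1); apply: rho_o_J_inv.
by apply: J_o_set_fun => //; [exact: (subfieldN sK)|exact: (subfieldV sK)].
Qed.

Lemma J_o_rho_o p : S_off K p -> J_o (rho_o p) = tT_o (J_o p).
Proof.
move=> Sp; rewrite rho_o_factor// J_invK//.
have [] // := @tT_o_set_fun (J_o p) _.
by apply: J_o_set_fun => //; [exact: (subfieldN sK)|exact: (subfieldV sK)].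
Qed.

Lemma rho_o_set_fun : set_fun (S_off K) (S_off K) rho_o.
Proof.
have KN := subfieldN sK; have KV := subfieldV sK.
move=> p Sp; rewrite rho_o_factor//; apply: J_inv_set_fun => //.
by apply: tT_o_set_fun; exact: J_o_set_fun.
Qed.

Context (KG : K G).

(** The second coordinate of the image determines the branch and [y], after
    which [u] and [s] are read off the other two.  The endpoints that the
    fibres of the branches miss are the inverses of numbers [2 n - 1 + G], up
    to sign, and these belong to [K]. *)
Lemma tT_o_bij : set_bij (tOmega_off K) (tOmega_off K) tT_o.
Proof.
split; first exact: tT_o_set_fun.
  move=> q q' /set_mem/tOmega_offP[m [e [u [y [s [me u01 _ [Iy _] [_ ->]]]]]]].
  move=> /set_mem/tOmega_offP[m' [e' [u' [y' [s' [me' u01' _ [Iy' _] [_ ->]]]]]]].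
  rewrite !tT_oE// => -[<- /branch_fibre_inj[]// <- <- <-] /oppr_inj ss.
  congr (_, _, _).
  by rewrite -[s]mul1r -[s']mul1r -(branch_sqr me) -!mulrA ss.
case=> [[u z] s] [[[/= + Iz] hs] [[/= Ku Kz] _]]; rewrite in_itv/= => u01.
have [m [e [y [me Iy zE]]]] : exists m e y,
    [/\ branch m e, I_G y & z = e / (2 * m%:R + 1 + y)].
  apply: branch_fibre_cover => // [|n].
    by apply/eqP => z0; apply: Kz; rewrite z0; exact: subfield0.
  apply/eqP => E; apply: Kz.
  have {}E : `|z|^-1 = (2 * n)%:R + G - 1 by rewrite natrM -E addrK.
  have Kaz : K `|z|.
    rewrite -[`|z|]invrK E; apply: (subfieldV sK); have [K1 KB _] := sK.
    by apply: KB => //; apply: (subfieldD sK) => //; exact: subfield_nat.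
  have [z0|z0] := ger0P z; first by rewrite ger0_norm in Kaz.
  by rewrite ltr0_norm// in Kaz; rewrite -[z]opprK; exact: subfieldN.
exists (1 / (2 * m%:R + 1 + e * u), y, - (e * s)).
  split; split=> //=.
  - split=> //=; rewrite in_itv/= div1r; have t1 := branch_gt1 me u01.
    by rewrite invr_gt0 invf_lt1; lra.
  - case: me => [->|[-> _]]; case: hs => ->; rewrite ?mul1r ?mulN1r ?opprK;
      by [left|right].
  - by split=> //=; [move/(subfield_base sK _ me)|
      move/(subfield_fibre sK _ me); rewrite -zE].
by rewrite tT_oE// -zE mulrN opprK mulrA (branch_sqr me) mul1r.
Qed.

Lemma rho_o_bij : set_bij (S_off K) (S_off K) rho_o.
Proof.
have KN := subfieldN sK; have KV := subfieldV sK.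
apply: (@eq_set_bijLR _ _ _ _ _ (J_inv \o (tT_o \o J_o))).
  by move=> p /set_mem; exact: rho_o_factor.
apply: set_bij_comp (J_inv_bij KN KV).
exact: set_bij_comp (J_o_bij KN KV) tT_o_bij.
Qed.

End NaturalExtension.
End Domains.

Theorem proposition3 (R : realType) :
  [/\ (* the arrows of the diagram *)
      set_fun S_o_irr S_o_irr (@rho_o R)
      /\ set_fun tOmega_o_irr tOmega_o_irr (@tT_o R),
      set_bij S_o tOmega_o (@J_o R)
      /\ set_bij S_o_irr tOmega_o_irr (@J_o R),
      invertible_mod_null
        ((@lebesgue_measure R) \x (@lebesgue_measure R))%E S_o (@rho_o R) &
      forall p : R * R, S_o_irr p -> J_o (rho_o p) = tT_o (J_o p)].
Proof.
have sQ := @is_subfield_rational R; have sA := @is_subfield_algebraic R.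
have JQ := J_o_bij (subfieldN sQ) (subfieldV sQ).
split; last by move=> p; exact: (J_o_rho_o sQ).
- by split; [exact: rho_o_set_fun sQ|exact: tT_o_set_fun sQ].
- split=> //.
  have := @J_o_bij R set0 (fun x => id) (fun x => id).
  by rewrite /S_off /tOmega_off !setC0 !setXTT !setIT.
- exists ((algebraic `*` setT) `|` (setT `*` algebraic)).
    exact/negligible_cross/countable_algebraic.
  have -> : S_o `\` ((algebraic `*` setT) `|` (setT `*` algebraic)) =
      S_off (@algebraic R).
    apply/seteqP; split=> -[x y] [Sxy].
      by move=> /not_orP[/= Kx Ky]; split=> //; split=> /= K; [apply: Kx|apply: Ky].
    by move=> [/= Kx Ky]; split=> // -[[]|[]].
  exact: rho_o_bij sA algebraic_G.
Qed.
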